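(* Let $\lambda$ be a non-zero cardinal and $n$ a positive integer with $n\leqslant\lambda$. If $(S,\tau_S)$ is a compact Hausdorff semitopological monoid then $\left(\mathscr{I}_\lambda^n(S),\tau_{\mathscr{I}}^{\mathbf{c}}\right)$ is a compact Hausdorff semitopological semigroup.
   Context: A semitopological semigroup is a Hausdorff topological space with a separately continuous semigroup operation. $\mathscr{I}_\lambda^n$ is the semigroup of all partial injective maps $\lambda\rightharpoonup\lambda$ of rank (cardinality of the range) at most $n$, with composition $x(\alpha\beta)=(x\alpha)\beta$. The semigroup $\mathscr{I}_\lambda^n(S)$ consists of all maps $\alpha_S\colon \mathrm{Gr}(\alpha)\to S$, where $\alpha\in\mathscr{I}_\lambda^n$ and $\mathrm{Gr}(\alpha)\subset\lambda\times\lambda$ is the graph of $\alpha$; the element with empty graph is denoted $0$. A non-zero element is written $\begin{pmatrix} x_1&\cdots&x_k\\ s_1&\cdots&s_k\\ y_1&\cdots&y_k\end{pmatrix}$ ($1\leqslant k\leqslant n$, the $x_l\in\lambda$ pairwise distinct, the $y_l\in\lambda$ pairwise distinct, $s_l\in S$), meaning $\alpha$ maps $x_l$ to $y_l$ and $\alpha_S$ sends $(x_l,y_l)$ to $s_l$; the order of the columns is immaterial. The product $\alpha_S\cdot\beta_S$ has as underlying partial map the composition $\alpha\beta$, and if $(a,b)\in\mathrm{Gr}(\alpha)$ is sent to $s$ by $\alpha_S$ and $(b,d)\in\mathrm{Gr}(\beta)$ is sent to $t$ by $\beta_S$, then $\alpha_S\cdot\beta_S$ sends $(a,d)$ to $st$;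 in particular the product is $0$ if $\alpha\beta$ is empty. Let $1_S$ be the unit of $S$. For ordered collections $(a_1,\ldots,a_k)$, $(b_1,\ldots,b_k)$ of $k$ distinct elements of $\lambda$, $1\leqslant k\leqslant n$, let $S^{(a_1,\ldots,a_k)}_{(b_1,\ldots,b_k)}$ be the set of all elements $\begin{pmatrix} a_1&\cdots&a_k\\ s_1&\cdots&s_k\\ b_1&\cdots&b_k\end{pmatrix}$ with $s_1,\ldots,s_k\in S$, and for $U\subseteq S$ let $[U]^{(a)}_{(b)}$ be the set of all $\begin{pmatrix} a\\ s\\ b\end{pmatrix}$ with $s\in U$. Define $\mathfrak{f}^{(a_1,\ldots,a_k)}_{(b_1,\ldots,b_k)}\colon\mathscr{I}_\lambda^n(S)\to\mathscr{I}_\lambda^n(S)$ by $$\alpha\mapsto\begin{pmatrix} a_1&\cdots&a_k\\ 1_S&\cdots&1_S\\ a_1&\cdots&a_k\end{pmatrix}\cdot\alpha\cdot\begin{pmatrix} b_1&\cdots&b_k\\ 1_S&\cdots&1_S\\ b_1&\cdots&b_k\end{pmatrix},$$ and let ${\Uparrow}S^{(a_1,\ldots,a_k)}_{(b_1,\ldots,b_k)}$ be the full preimage of $S^{(a_1,\ldots,a_k)}_{(b_1,\ldots,b_k)}$ under $\mathfrak{f}^{(a_1,\ldots,a_k)}_{(b_1,\ldots,b_k)}$, and ${\Uparrow}[U]^{(a)}_{(b)}$ the full preimage of $[U]^{(a)}_{(b)}$ under $\mathfrak{f}^{(a)}_{(b)}$. The topology $\tau_{\mathscr{I}}^{\mathbf{c}}$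 on $\mathscr{I}_\lambda^n(S)$ is generated by the subbase consisting of all sets $\mathscr{I}_\lambda^n(S)\setminus{\Uparrow}S^{(a_1,\ldots,a_k)}_{(b_1,\ldots,b_k)}$, where $k=1,\ldots,n$ and $(a_1,\ldots,a_k)$, $(b_1,\ldots,b_k)$ are ordered collections of $k$ distinct elements of $\lambda$, and all sets ${\Uparrow}[U(s)]^{(a)}_{(b)}$, where $a,b\in\lambda$, $s\in S$ and $U(s)$ is an open neighbourhood of $s$ in $(S,\tau_S)$. *)

(* Defs.v *)
From HB Require Import structures.
From mathcomp Require Import all_boot.
From mathcomp Require Import boolp classical_sets functions cardinality.
From mathcomp Require Import topology.

Set Implicit Arguments.
Unset Strict Implicit.
Unset Printing Implicit Defensive.

Local Open Scope classical_set_scope.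
Local Open Scope card_scope.
Local Open Scope group_scope.

(* A semigroup (monoid) that carries a topology; no compatibility between the
   two is required here. *)
#[short(type="topSemigroupType")]
HB.structure Definition TopSemigroup := {T of Semigroup T & Topological T}.

#[short(type="topMonoidType")]
HB.structure Definition TopMonoid := {T of Monoid T & Topological T}.

(* Associativity of the operation is part of topSemigroupType. *)
Definition semitopological_semigroup (T : topSemigroupType) : Prop :=
  hausdorff_space T /\
  (forall a : T, continuous (fun x : T => a * x) /\
                 continuous (fun x : T => x * a)).

Definition partial_injective (L : Type) (al : L -> option L) : Prop :=
  forall x1 x2 y, al x1 = Some y -> al x2 = Some y -> x1 = x2.

Definition rank_le (L : Type) (n : nat) (al : L -> option L) : Prop :=
  [set y | exists x, al x = Some y] #<= `I_n.

(* The semigroup I_L^n(S).  Since x |-> (x, al x) is a bijection from the domain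
   of al onto Gr(al), a map al_S : Gr(al) -> S is encoded by a single partial
   function: f x = Some (y, s) means that al maps x to y and that al_S sends
   (x, y) to s. *)
Definition underlying (L S : Type) (f : L -> option (L * S)) : L -> option L :=
  fun x => omap fst (f x).

Record lpinj (L : Type) (n : nat) (S : Type) := LPInj {
  lpfun :> L -> option (L * S);
  lpfun_inj : partial_injective (underlying lpfun);
  lpfun_rank : rank_le n (underlying lpfun)
}.

Arguments LPInj {L n S lpfun} lpfun_inj lpfun_rank.
Arguments lpfun_inj {L n S} l [x1 x2 y].
Arguments lpfun_rank {L n S} l.

HB.instance Definition _ (L : Type) (n : nat) (S : Type) :=
  gen_eqMixin (lpinj L n S).
HB.instance Definition _ (L : Type) (n : nat) (S : Type) :=
  gen_choiceMixin (lpinj L n S).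

Lemma lpinj_ext (L : Type) (n : nat) (S : Type) (f g : lpinj L n S) :
  (forall x, f x = g x) -> f = g.
Proof.
case: f g => f fi fr [g gi gr] /= /funext fg; subst g.
by congr LPInj; exact: Prop_irrelevance.
Qed.

Section Product.
Variables (L : Type) (n : nat).

Definition lpcomp (S : magmaType) (f g : L -> option (L * S)) :
    L -> option (L * S) :=
  fun a => if f a is Some (b, s) then
             if g b is Some (d, t) then Some (d, s * t) else None
           else None.

Lemma underlying_lpcomp (S : magmaType) (f g : L -> option (L * S)) a :
  underlying (lpcomp f g) a = obind (underlying g) (underlying f a).
Proof.
by rewrite /underlying /lpcomp; case: (f a) => [[b s]|//] /=; case: (g b) => [[]|].
Qed.

Lemma lpcomp_inj (S : magmaType) (f g : lpinj L n S) :
  partial_injective (underlying (lpcomp f g)).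
Proof.
move=> x1 x2 y; rewrite !underlying_lpcomp.
case E1: (underlying f x1) => [b1|//] /= g1.
case E2: (underlying f x2) => [b2|//] /= g2.
by move: E2; rewrite -(lpfun_inj g g1 g2) => E2; exact: lpfun_inj E1 E2.
Qed.

Lemma lpcomp_rank (S : magmaType) (f g : lpinj L n S) :
  rank_le n (underlying (lpcomp f g)).
Proof.
apply: card_le_trans (lpfun_rank g); apply: subset_card_le => y [x] /=.
by rewrite underlying_lpcomp; case: (underlying f x) => [b|//] /= gb; exists b.
Qed.

Definition lpmul (S : magmaType) (f g : lpinj L n S) : lpinj L n S :=
  LPInj (@lpcomp_inj S f g) (lpcomp_rank f g).

Lemma lpmulA (S : semigroupType) : associative (@lpmul S).
Proof.
move=> f g h; apply: lpinj_ext => x; rewrite /= /lpcomp /=.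
case: (f x) => [[b s]|//]; rewrite /lpcomp; case: (g b) => [[d t]|//].
by case: (h d) => [[e u]|//]; rewrite mulgA.
Qed.

End Product.

HB.instance Definition _ (L : Type) (n : nat) (S : semigroupType) :=
  isSemigroup.Build (lpinj L n S) (@lpmulA L n S).

Section Columns.
Variables (L : Type) (n : nat) (S : Type) (k : nat).
Variables (a b : 'I_k -> L).

Definition columns_fun (s : 'I_k -> S) : L -> option (L * S) :=
  fun x => omap (fun i => (b i, s i)) [pick i | `[< a i = x >]].

Lemma columns_funP (a_inj : injective a) (s : 'I_k -> S) x y t :
  columns_fun s x = Some (y, t) <->
  exists i, [/\ a i = x, b i = y & s i = t].
Proof.
rewrite /columns_fun; case: pickP => [i /asboolP aix|no]; split => //=.
- by case=> <- <-; exists i.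
- by move=> [j [ajx <- <-]]; rewrite (a_inj i j) // aix ajx.
- by move=> [i [/asboolP]]; rewrite no.
Qed.

Lemma columns_inj (a_inj : injective a) (b_inj : injective b) s :
  partial_injective (underlying (columns_fun s)).
Proof.
rewrite /underlying => x1 x2 y.
case E1: (columns_fun s x1) => [[y1 t1]|//] [<-].
case E2: (columns_fun s x2) => [[y2 t2]|//] [].
case/(columns_funP a_inj): E1 => i [<- <- _].
by case/(columns_funP a_inj): E2 => j [<- <- _] /b_inj ->.
Qed.

Lemma columns_rank (k_le_n : (k <= n)%N) s :
  rank_le n (underlying (columns_fun s)).
Proof.
apply: (@card_le_trans _ _ _ [set: 'I_k]).
  apply: card_le_trans (card_image_le b _); apply: subset_card_le => y [x] /=.
  rewrite /underlying /columns_fun; case: pickP => //= i _ [<-].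
  by exists i.
rewrite -(card_le_eql (@card_II k)) card_le_II //.
Qed.

(* The element with columns (a_i, s_i, b_i), i < k. *)
Definition columns (k_le_n : (k <= n)%N) (a_inj : injective a)
    (b_inj : injective b) (s : 'I_k -> S) : lpinj L n S :=
  LPInj (@columns_inj a_inj b_inj s) (columns_rank k_le_n s).

(* With U = setT this is S^(a_1,...,a_k)_(b_1,...,b_k), and with k = 1 this is
   [U]^(a)_(b). *)
Definition block (k_le_n : (k <= n)%N) (a_inj : injective a)
    (b_inj : injective b) (U : set S) : set (lpinj L n S) :=
  [set columns k_le_n a_inj b_inj s | s in [set s | forall i, U (s i)]].

End Columns.

Section Topology.
Variables (L : Type) (n : nat).

(* The map alpha |-> e_a * alpha * e_b, with e_a, e_b the partial identities on
   {a_i} and {b_i} labelled by 1. *)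
Definition corner (S : monoidType) (k : nat) (a b : 'I_k -> L)
    (k_le_n : (k <= n)%N) (a_inj : injective a) (b_inj : injective b)
    (al : lpinj L n S) : lpinj L n S :=
  columns k_le_n a_inj a_inj (fun=> 1) * al
  * columns k_le_n b_inj b_inj (fun=> 1).

Definition up_block (S : monoidType) (k : nat) (a b : 'I_k -> L)
    (k_le_n : (k <= n)%N) (a_inj : injective a) (b_inj : injective b)
    (U : set S) : set (lpinj L n S) :=
  corner k_le_n a_inj b_inj @^-1` block k_le_n a_inj b_inj U.

Lemma inj_const1 (a : L) : injective (fun _ : 'I_1 => a).
Proof. by move=> i j _; rewrite !ord1. Qed.

Definition subbase_compl (S : topMonoidType) : set_system (lpinj L n S) :=
  [set W | exists (k : nat) (a b : 'I_k -> L) (k_le_n : (k <= n)%N)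
      (a_inj : injective a) (b_inj : injective b),
      (0 < k)%N /\ W = ~` up_block k_le_n a_inj b_inj [set: S]].

Definition subbase_up (S : topMonoidType) : set_system (lpinj L n S) :=
  [set W | exists (a b : L) (n_gt0 : (0 < n)%N) (s : S) (U : set S),
      open_nbhs s U /\
      W = up_block n_gt0 (@inj_const1 a) (@inj_const1 b) U].

Definition tauc_subbase (S : topMonoidType) : set_system (lpinj L n S) :=
  @subbase_compl S `|` @subbase_up S.

End Topology.

HB.instance Definition _ (L : Type) (n : nat) (S : topMonoidType) :=
  isSubBaseTopological.Build (lpinj L n S) (@tauc_subbase L n S) id.

(* Main.v *)
Require Import Defs.
From HB Require Import structures.
From mathcomp Require Import all_boot.
From mathcomp Require Import boolp classical_sets functions cardinality.
From mathcomp Require Import topology.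

Set Implicit Arguments.
Unset Strict Implicit.
Unset Printing Implicit Defensive.

Local Open Scope classical_set_scope.
Local Open Scope card_scope.

(** Send [al] to the family, indexed by the pairs (a, b) of points of [L], whose
    (a, b)-coordinate is the label [s] if [al] maps [a] to [b] with label [s],
    and an extra isolated point if [al] does not map [a] to [b].  The topology
    of the theorem is the one induced by this embedding into a power of the
    compact Hausdorff space obtained from [S] by adding an isolated point:
    the up-set of a block of [k] columns is an intersection of [k] up-sets of
    one-column blocks ([up_blockP]), so the subbase may be cut down to the
    cylinders [entry a b U] with [U] open and the complements of the
    [entry a b setT] ([cvg_lpinj], [open_entry], [open_nentry]).

    Hausdorffness follows, because two distinct elements differ in some
    coordinate.  The image of the embedding is closed, because being a partial
    map, being injective and having rank at most [n] only forbid finite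
    configurations of entries; this gives compactness.  Below this is carried
    out with an ultrafilter: its limit is computed point by point
    ([ultra_entry]), and any finite piece of the limit is a piece of some
    element of the semigroup, hence is injective and has at most [n] points.

    A translation is continuous because each coordinate of a product is either
    constantly the isolated point or a translate in [S] of one single
    coordinate of the moving factor; for [al * be] as a function of [al] this
    uses that [be] is injective, so that the intermediate point is determined
    by the target. *)

(** * Sets whose finite subsets are small *)

(** An infinite set contains a copy of every initial segment of the naturals, in
    particular one of [n.+1] points.  This reduces the rank bound of the limit
    of an ultrafilter to finitely many entries at a time. *)
Lemma card_le_finite_subsets (T : Type) (A : set T) (n : nat) :
  (forall B, finite_set B -> B `<=` A -> B #<= `I_n) -> A #<= `I_n.
Proof.
elim/Ppointed: T => T in A *; first by rewrite emptyE => _; exact: card_ge0.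
move=> small; have [finA|/infiniteP natA] := pselect (finite_set A); first exact: (small A).
have /pcard_leP[f] : `I_n.+1 #<= A.
  by apply: card_le_trans natA; exact: subset_card_le.
have fA : f @` `I_n.+1 `<=` A by move=> _ [i iI <-]; exact: funS.
have := small _ (finite_image _ (finite_II _)) fA.
by rewrite (card_le_eql (card_image _)) card_le_II ltnn.
Qed.

(** * The cylinders of the topology *)

Section Entries.
Variables (L : Type) (n : nat) (S : topMonoidType).
Hypothesis n_gt0 : (0 < n)%N.
Implicit Types (a b : L) (U : set S) (al be : lpinj L n S).

Definition entry a b U : set (lpinj L n S) :=
  [set al | exists2 s, U s & al a = Some (b, s)].

(** Multiplying by the two partial identities labelled by 1 cuts [al] down to the
    arrows from the [a i] to the [b j], with their labels unchanged. *)
Lemma cornerE k (a b : 'I_k -> L) (k_le_n : (k <= n)%N) (a_inj : injective a)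
    (b_inj : injective b) al x y s :
  corner k_le_n a_inj b_inj al x = Some (y, s) <->
  [/\ exists i, a i = x, exists j, b j = y & al x = Some (y, s)].
Proof.
rewrite /corner /= /lpcomp /=.
case Ea: (columns_fun a a (fun=> 1%g) x) => [[x' t]|]; last first.
  split=> // -[[i ai] _ _].
  have : columns_fun a a (fun=> 1%g : S) x = Some (x, 1%g).
    by apply/(columns_funP _ a_inj); exists i.
  by rewrite Ea.
case/(columns_funP _ a_inj): Ea => i [aix aix' <-].
rewrite -{}aix' aix; case Eal: (al x) => [[y' u]|]; last by split=> // -[].
rewrite mul1g.
case Eb: (columns_fun b b (fun=> 1%g) y') => [[z t']|].
  case/(columns_funP _ b_inj): Eb => j [bjy' bjz <-].
  rewrite mulg1 -bjz bjy'; split=> [[<- <-]|[_ _ [<- <-]]] //.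
  by split=> //; [exists i|exists j].
split=> // -[_ [j bj] [yy' _]].
have : columns_fun b b (fun=> 1%g : S) y' = Some (y', 1%g).
  by apply/(columns_funP _ b_inj); exists j; split=> //; rewrite yy'.
by rewrite Eb.
Qed.

(** The corner of [al] is defined at most at the [a i], so once [al] has an arrow
    from each [a i] to [b i], its corner has no others; hence lying in the
    up-set is a condition on each column separately. *)
Lemma up_blockP k (a b : 'I_k -> L) (k_le_n : (k <= n)%N) (a_inj : injective a)
    (b_inj : injective b) U al :
  up_block k_le_n a_inj b_inj U al <-> forall i, entry (a i) (b i) U al.
Proof.
split=> [[s Us cornerE_al] i|entries].
  exists (s i); first exact: Us.
  have : corner k_le_n a_inj b_inj al (a i) = Some (b i, s i).
    by rewrite -cornerE_al; apply/columns_funP => //; exists i.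
  by case/cornerE.
have /choice[s sP] i : exists t, U t /\ al (a i) = Some (b i, t).
  by have [t Ut alai] := entries i; exists t.
exists s => [i|]; first by case: (sP i).
apply: lpinj_ext => x; rewrite [LHS]/=.
have columns_corner y t : columns_fun a b s x = Some (y, t) <->
    corner k_le_n a_inj b_inj al x = Some (y, t).
  rewrite cornerE columns_funP //; split=> [[i [<- <- <-]]|[[i <-] _]].
    by split; [exists i|exists i|case: (sP i)].
  by case: (sP i) => _ -> [<- <-]; exists i.
case E: (columns_fun a b s x) => [[y t]|]; first by rewrite ((columns_corner _ _).1 E).
case E': (corner _ _ _ al x) => [[y t]|] //.
by rewrite ((columns_corner _ _).2 E') in E.
Qed.

Lemma up_block1E a b U :
  up_block n_gt0 (@inj_const1 L a) (@inj_const1 L b) U = entry a b U.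
Proof.
apply/seteqP; split=> al; first by move/up_blockP/(_ ord0).
by move=> ent; apply/up_blockP.
Qed.

Lemma open_subbase (W : set (lpinj L n S)) : tauc_subbase W -> open W.
Proof.
move=> subW; exists [set W]; last by rewrite bigcup_set1.
by move=> _ ->; exact: (@finI_from1 _ _ _ id).
Qed.

Lemma open_entry a b U : open U -> open (entry a b U).
Proof.
move=> oU; have [[s Us]|/nonemptyPn ->] := pselect (U !=set0); last first.
  suff -> : entry a b set0 = set0 by exact: open0.
  by apply/seteqP; split=> // al [].
rewrite -up_block1E; apply: open_subbase; right.
by exists a, b, n_gt0, s, U.
Qed.

Lemma open_nentry a b : open (~` entry a b setT).
Proof.
rewrite -up_block1E; apply: open_subbase; left.
by exists 1, (fun=> a), (fun=> b), n_gt0, (@inj_const1 L a), (@inj_const1 L b).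
Qed.

Lemma nbhs_entry a b U al : open U -> entry a b U al -> nbhs al (entry a b U).
Proof. by move=> oU alU; apply: open_nbhs_nbhs; split=> //; exact: open_entry. Qed.

Lemma nbhs_nentry a b al :
  ~ entry a b setT al -> nbhs al (~` entry a b setT).
Proof. by move=> nal; apply: open_nbhs_nbhs; split=> //; exact: open_nentry. Qed.

Lemma cvg_subbase (F : set_system (lpinj L n S)) al : Filter F ->
  (forall W, tauc_subbase W -> W al -> F W) -> F --> al.
Proof.
move=> FF FW A; rewrite nbhsE => -[B [[D sD <-] [C DC Cal]] sBA].
apply: filterS sBA _; apply: (@filterS _ _ _ C); first by move=> x Cx; exists C.
have [E sE CE] := sD _ DC; rewrite -CE; apply: filter_bigI => W WE.
by apply: FW; [move: (sE _ WE); rewrite inE|move: Cal; rewrite -CE; exact].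
Qed.

(** One-column cylinders and their complements suffice to test convergence: by
    [up_blockP], leaving the up-set of a block of [k] columns means leaving the
    up-set of one of its columns. *)
Lemma cvg_lpinj (F : set_system (lpinj L n S)) al : Filter F ->
    (forall a b U, open U -> entry a b U al -> F (entry a b U)) ->
    (forall a b, ~ entry a b setT al -> F (~` entry a b setT)) ->
  F --> al.
Proof.
move=> FF Fentry Fnentry; apply: cvg_subbase => W [].
  move=> [k [a [b [k_le_n [a_inj [b_inj [_ ->]]]]]]] nal.
  have [i nali] : exists i, ~ entry (a i) (b i) setT al.
    by apply/existsNP => ents; apply: nal; exact/up_blockP.
  apply: filterS (Fnentry _ _ nali) => be nbe /up_blockP ents.
  exact: nbe (ents i).
move=> [a [b [lt0n [s [U [[oU _] ->]]]]]] /up_blockP/(_ ord0) ent.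
by apply: filterS (Fentry _ _ _ oU ent) => be ? ; apply/up_blockP.
Qed.

Lemma continuous_lpinj (g : lpinj L n S -> lpinj L n S) :
    (forall al a b U, open U -> entry a b U (g al) ->
      nbhs al (g @^-1` entry a b U)) ->
    (forall al a b, ~ entry a b setT (g al) ->
      nbhs al (g @^-1` ~` entry a b setT)) ->
  continuous g.
Proof.
move=> gentry gnentry al; apply: cvg_lpinj; last exact: gnentry.
  exact: (fmap_filter _ (nbhs_filter al)).
exact: gentry.
Qed.

(** * Separation *)

(** If [al] maps [a] to [b], then [entry a b setT] is a clopen set containing
    [al], hence all the points that are not separated from [al]; once the arrow
    is the same, the labels are compared in [S]. *)
Lemma lpinj_hausdorff : hausdorff_space S -> hausdorff_space (lpinj L n S).
Proof.
move=> hS.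
suff sub al be a b s : cluster (nbhs al) be ->
    al a = Some (b, s) -> be a = Some (b, s).
  move=> al be clab; have clba : cluster (nbhs be) al.
    by move=> A B nA nB; rewrite setIC; exact: clab.
  apply: lpinj_ext => a; case E: (al a) => [[b s]|]; first by rewrite (sub _ _ _ _ _ clab E).
  by case E': (be a) => [[b s]|] //; rewrite (sub _ _ _ _ _ clba E') in E.
move=> clab ala; have alT U : U s -> entry a b U al by exists s.
have [[t _ bea]|/nbhs_nentry nbe] := pselect (entry a b setT be); last first.
  by have [ga []] := clab _ _ (nbhs_entry openT (alT _ I)) nbe.
rewrite bea; congr (Some (b, _)); apply/esym/hS => A B.
rewrite !nbhsE => -[A' [oA' A's] sA] [B' [oB' B't] sB].
have beB' : entry a b B' be by exists t.
have [ga [[u A'u gau] [v B'v gav]]] :=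
  clab _ _ (nbhs_entry oA' (alT _ A's)) (nbhs_entry oB' beB').
by exists u; split; [exact: sA|apply: sB; move: gau; rewrite gav => -[<-]].
Qed.

(** * Compactness *)

(** Where [al] is undefined the value is arbitrary; [label a] is only looked at
    on the cylinders [entry a b setT]. *)
Definition label a al : S := if al a is Some (_, s) then s else 1%g.

(** The value at [a] of the limit of an ultrafilter.  If some [entry a b setT]
    is in [F], the labels at [a] cluster at some [s] in the compact space [S],
    and an ultrafilter converges to its cluster points; otherwise [F] contains
    all the complements, and the limit is undefined at [a]. *)
Lemma ultra_entry (F : set_system (lpinj L n S)) (FU : UltraFilter F) a :
    compact [set: S] ->
  exists p : option (L * S), match p with
    | Some (b, s) => forall U, open U -> U s -> F (entry a b U)
    | None => forall b, F (~` entry a b setT)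
    end.
Proof.
move=> cS.
have [[b Fb]|noF] := pselect (exists b, F (entry a b setT)); last first.
  exists None => b; have [Fb|//] := in_ultra_setVsetC (entry a b setT) FU.
  by case: noF; exists b.
have [s [_ cls]] := cS (label a @ F) _ filterT.
exists (Some (b, s)) => U oU Us.
have [FU'|FnU] := in_ultra_setVsetC (label a @^-1` U) FU.
  apply: filterS (filterI FU' Fb) => al [] /=; rewrite /label => alU [t _ Et].
  by exists t => //; move: alU; rewrite Et.
by have [t []] := cls (~` U) U FnU (open_nbhs_nbhs (conj oU Us)).
Qed.

Lemma lpinj_compact : compact [set: S] -> compact [set: lpinj L n S].
Proof.
move=> cS; rewrite compact_ultra => F FU _.
have [f fP] := choice (fun a => ultra_entry FU a cS).
have Fentry a b s U : f a = Some (b, s) -> open U -> U s -> F (entry a b U).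
  by move=> fa; move: (fP a); rewrite fa; exact.
have f_inj : partial_injective (underlying f).
  rewrite /underlying => x1 x2 y.
  case E1: (f x1) => [[y1 s1]|//] [<-]; case E2: (f x2) => [[y2 s2]|//] [y21].
  have F1 := Fentry _ _ _ _ E1 openT I; have F2 := Fentry _ _ _ _ E2 openT I.
  have [al [[t1 _ al1] [t2 _ al2]]] := filter_ex (filterI F1 F2).
  by apply: (lpfun_inj al); rewrite /underlying ?al1 ?al2 //= y21.
have f_rank : rank_le n (underlying f).
  apply: card_le_finite_subsets => B.
  move=> /(@finite_fsetP {classic L})[X BX] Bran.
  have /choice[x xP] y : exists z, B y -> underlying f z = Some y.
    by have [/Bran[z fz]|nBy] := pselect (B y); [exists z|exists y].
  (* An element of this finite intersection has all of [B] in its range. *)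
  have : F (\bigcap_(y in B) entry (x y) y setT).
    rewrite BX; apply: (@filter_bigI _ {classic L}) => y yX; have /xP : B y by rewrite BX.
    rewrite /underlying; case E: (f (x y)) => [[b s]|//] [yb].
    by apply: (Fentry _ _ _ _ _ openT I); rewrite E yb.
  move=> /filter_ex[al alB]; apply: card_le_trans (lpfun_rank al).
  apply: subset_card_le => y /alB[s _ aly]; exists (x y).
  by rewrite /underlying aly.
exists (LPInj f_inj f_rank); split=> //; apply: cvg_lpinj => a b.
  by move=> U oU [s Us fa]; exact: Fentry fa oU Us.
move=> nfa; move: (fP a) (nfa); rewrite /entry /=.
case: (f a) => [[b' s] Fb'|] nb; last exact.
apply: filterS (Fb' setT openT I) => al [t _ al1] [u _ al2].
by apply: nb; exists s => //; move: al1; rewrite al2 => -[<-].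
Qed.

(** * Translations *)

Lemma entry_mul a d U al be :
  entry a d U (al * be)%g <->
  exists b s t, [/\ al a = Some (b, s), be b = Some (d, t) & U (s * t)%g].
Proof.
rewrite /entry /= /lpcomp; split=> [[u Uu]|[b [s [t [-> -> Ust]]]]]; last first.
  by exists (s * t)%g.
case E: (al a) => [[b s]|//]; case E': (be b) => [[d' t]|//] [<- ust].
by exists b, s, t; split=> //; rewrite ust.
Qed.

(** The arrow of [be * al] at [a] is the arrow of [al] at the fixed point [b]
    that [be] assigns to [a], with its label translated. *)
Lemma mull_continuous (be : lpinj L n S) :
    (forall t : S, continuous (fun s : S => t * s)%g) ->
  continuous (fun al : lpinj L n S => be * al)%g.
Proof.
move=> cS; apply: continuous_lpinj => al a d.
  move=> U oU /entry_mul[b [t [s [bea alb Uts]]]].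
  have oV : open ((fun s => t * s)%g @^-1` U).
    by apply: open_comp => // ? _; exact: cS.
  have : entry b d ((fun s => t * s)%g @^-1` U) al by exists s.
  move=> /(nbhs_entry oV); apply: filterS => al' [s' Uts' alb'].
  by apply/entry_mul; exists b, t, s'.
move=> nbeal; case E: (be a) => [[b t]|]; last first.
  by apply: filterE => al' /entry_mul[b [t [s []]]]; rewrite E.
have : ~ entry b d setT al.
  by move=> [s _ alb]; apply: nbeal; apply/entry_mul; exists b, t, s.
move=> /nbhs_nentry; apply: filterS => al' nal' /entry_mul[b' [t' [s []]]].
by rewrite E => -[<- _] alb _; apply: nal'; exists s.
Qed.

(** The point [b] through which an arrow of [al * be] to [d] passes does not
    depend on [al]: it is the unique preimage of [d] under [be]. *)
Lemma mulr_continuous (be : lpinj L n S) :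
    (forall t : S, continuous (fun s : S => s * t)%g) ->
  continuous (fun al : lpinj L n S => al * be)%g.
Proof.
move=> cS; apply: continuous_lpinj => al a d.
  move=> U oU /entry_mul[b [s [t [ala beb Ust]]]].
  have oV : open ((fun s => s * t)%g @^-1` U).
    by apply: open_comp => // ? _; exact: cS.
  have : entry a b ((fun s => s * t)%g @^-1` U) al by exists s.
  move=> /(nbhs_entry oV); apply: filterS => al' [s' Ust' ala'].
  by apply/entry_mul; exists b, s', t.
move=> nalbe.
have [[b [t beb]]|nod] := pselect (exists b t, be b = Some (d, t)); last first.
  by apply: filterE => al' /entry_mul[b [s [t [_ beb _]]]]; apply: nod; exists b, t.
have : ~ entry a b setT al.
  by move=> [s _ ala]; apply: nalbe; apply/entry_mul; exists b, s, t.
move=> /nbhs_nentry; apply: filterS => al' nal' /entry_mul[b' [s [t' [ala beb' _]]]].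
apply: nal'; exists s => //; rewrite ala; congr (Some (_, _)).
by apply: (lpfun_inj be); rewrite /underlying ?beb ?beb'.
Qed.

End Entries.

Theorem theorem5p14 (L : Type) (n : nat) (S : topMonoidType)
    (L_neq0 : [set: L] !=set0) (n_gt0 : (0 < n)%N)
    (n_le_L : `I_n #<= [set: L])
    (S_compact : compact [set: S])
    (S_hausdorff : hausdorff_space S)
    (S_semitop : semitopological_semigroup S) :
  [/\ compact [set: lpinj L n S],
      hausdorff_space (lpinj L n S) &
      semitopological_semigroup (lpinj L n S : topSemigroupType)].
Proof.
have [_ cS] := S_semitop.
split; [exact: lpinj_compact|exact: lpinj_hausdorff|split].
  exact: lpinj_hausdorff.
move=> be; split.
  by apply: mull_continuous => // t; case: (cS t).
by apply: mulr_continuous => // t; case: (cS t).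
Qed.
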